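(* Let $J$ be a $\times d$-invariant set satisfying (i) $d$ is prime and (ii) $0,d-1\in E$ and $E$ contains no two integers differing by $1$. Let $\delta$ be the Hausdorff dimension of $J$ and $\mu=\mathcal{H}^\delta|_J/\mathcal{H}^\delta(J)$. Then for $\mu$-almost every $x\in J$ and every constant $K>0$, the set of $y\in J_x$ that are badly intrinsically approximable (relative to $J_x$) with respect to the constant function $\psi(q)=K$ has Hausdorff dimension $\delta$.
   Context: Fix an integer $d\ge2$ and $E\subseteq\{0,\dots,d-1\}$ with $1<\#E<d$. The $\times d$-invariant set is $J=\{x\in[0,1]: x=\sum_{i\ge1}a_id^{-i}\text{ with all }a_i\in E\}$. For $x\in\mathbb{R}$, $J_x=\{t-x:t\in J\}$. For $S\subseteq\mathbb{R}$, $\psi:\mathbb{N}\to(0,\infty)$: $y\in S$ is intrinsically approximable w.r.t. $\psi$ if there are infinitely many $p/q\in\mathbb{Q}\cap S$ (lowest terms) with $|y-p/q|\le\psi(q)/q$; $y$ is badly intrinsically approximable w.r.t. $\psi$ if for some $\varepsilon>0$ it is not intrinsically approximable w.r.t. $\varepsilon\psi$. *)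

(* Defs.v *)
From Stdlib Require Import Reals ZArith Znumtheory List.
Open Scope R_scope.

(* The x d-invariant set J = { sum_{i>=1} a_i d^{-i} : a_i in E }.
   The digit sequence is indexed from 0: a 0 is the first digit. *)
Definition Jset (d : nat) (E : list nat) (x : R) : Prop :=
  exists a : nat -> nat,
    (forall i, In (a i) E) /\
    infinite_sum (fun i => INR (a i) / INR d ^ (S i)) x.

Definition translate (S : R -> Prop) (x : R) (y : R) : Prop :=
  exists t, S t /\ y = t - x.

Definition good_approx (S : R -> Prop) (psi : nat -> R) (y : R) (p q : Z) : Prop :=
  (0 < q)%Z /\ Z.gcd p q = 1%Z /\ S (IZR p / IZR q) /\
  Rabs (y - IZR p / IZR q) <= psi (Z.to_nat q) / IZR q.

Definition intrinsically_approximable (S : R -> Prop) (psi : nat -> R) (y : R) : Prop :=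
  S y /\
  ~ (exists l : list (Z * Z),
       forall p q, good_approx S psi y p q -> In (p, q) l).

Definition badly_intrinsically_approximable (S : R -> Prop) (psi : nat -> R) (y : R) : Prop :=
  S y /\
  exists eps, 0 < eps /\
    ~ intrinsically_approximable S (fun q => eps * psi q) y.

(* H^s(A) = 0 (Hausdorff s-measure zero), for s > 0:
   for all delta, eps > 0 there is a countable cover of A by sets U n of
   diameter at most D n, with 0 < D n < delta and sum_n (D n)^s < eps. *)
Definition Hausdorff_null (s : R) (A : R -> Prop) : Prop :=
  forall delta eps, 0 < delta -> 0 < eps ->
    exists (U : nat -> R -> Prop) (D : nat -> R) (l : R),
      (forall x, A x -> exists n, U n x) /\
      (forall n, 0 < D n < delta) /\
      (forall n a b, U n a -> U n b -> Rabs (a - b) <= D n) /\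
      infinite_sum (fun n => Rpower (D n) s) l /\ l < eps.

Definition is_glb (P : R -> Prop) (m : R) : Prop :=
  (forall s, P s -> m <= s) /\ (forall m', (forall s, P s -> m' <= s) -> m' <= m).

Definition Hausdorff_dim (A : R -> Prop) (delta : R) : Prop :=
  is_glb (fun s => 0 < s /\ Hausdorff_null s A) delta.

(* Main.v *)
(* Write u for the digits of x. For almost every x, u contains, for every M and arbitrarily far out,
   the word 0^(M+1) (d-1)^M 0^M: avoiding a fixed word costs a factor < 1 per block of digits.
   If t in J and t - x = p/q, the differences of the shifts of t and x are multiples of 1/q which
   are periodic modulo 1; comparing them along such a word, the gap condition on E forces them to
   become integers, hence 0. So t and u have the same digits from some rank on, q divides a power
   of d, and, d being prime, q = d^k where the digits of t and u agree from rank k on.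
   Points of J whose first n digits differ are at distance at least d^-n. Therefore any s in J whose
   digits differ from u at all multiples of m satisfies |s - t| >= d^-(k+m) for all these t, so that
   s - x is badly approximable. Such s form a Cantor set whose dimension tends to
   log #E / log d = delta as m grows. The lower bound for its dimension is the mass distribution
   principle, carried out by descending the tree of cylinders: at each node some child does not
   increase the conditional mass of the given cover, and the resulting branch is not covered. *)
Require Import Defs.
From Stdlib Require Import Reals ZArith Znumtheory List.
From Stdlib Require Import Lra Lia Cantor Classical ClassicalEpsilon.
From Coquelicot Require Import Coquelicot.
Open Scope R_scope.

(** * Base-[d] expansions *)

Definition val (d : nat) (a : nat -> nat) : R :=
  Series (fun i => INR (a i) / INR d ^ S i).

Definition shift (k : nat) (a : nat -> nat) : nat -> nat := fun i => a (k + i)%nat.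

Definition digits (E : list nat) (a : nat -> nat) : Prop := forall i, In (a i) E.

Lemma INR_base_ge2 (d : nat) : (2 <= d)%nat -> 2 <= INR d.
Proof. intros H; apply le_INR in H; simpl in H; lra. Qed.

Lemma INR_digit_le (d n : nat) : (n < d)%nat -> INR n <= INR d - 1.
Proof. intros H; apply le_INR in H; rewrite S_INR in H; lra. Qed.

Lemma ex_series_expansion (d : nat) (a : nat -> nat) :
  (2 <= d)%nat -> (forall i, (a i < d)%nat) ->
  ex_series (fun i => INR (a i) / INR d ^ S i).
Proof.
  intros hd ha.
  pose proof (INR_base_ge2 d hd) as h2.
  apply (ex_series_le (V := R_CompleteNormedModule) _ (fun i => (/ INR d) ^ i)).
  - intros i.
    assert (hp : 0 < INR d ^ i) by (apply pow_lt; lra).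
    unfold norm; simpl; unfold abs; simpl.
    pose proof (INR_digit_le d (a i) (ha i)) as h.
    pose proof (pos_INR (a i)) as h'.
    rewrite Rabs_pos_eq.
    + rewrite pow_inv.
      apply (Rmult_le_reg_r (INR d * INR d ^ i)); [nra|].
      field_simplify; [nra|lra|lra].
    + apply Rle_mult_inv_pos; [lra|nra].
  - apply ex_series_geom. rewrite Rabs_pos_eq.
    + rewrite <- Rinv_1. apply Rinv_lt_contravar; lra.
    + left; apply Rinv_0_lt_compat; lra.
Qed.

Lemma infinite_sum_val (d : nat) (a : nat -> nat) :
  (2 <= d)%nat -> (forall i, (a i < d)%nat) ->
  infinite_sum (fun i => INR (a i) / INR d ^ S i) (val d a).
Proof.
  intros hd ha. apply is_series_Reals, Series_correct, ex_series_expansion; auto.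
Qed.

Lemma val_infinite_sum (d : nat) (a : nat -> nat) (x : R) :
  infinite_sum (fun i => INR (a i) / INR d ^ S i) x -> x = val d a.
Proof.
  intros h. symmetry. apply is_series_unique, is_series_Reals, h.
Qed.

Lemma val_shift1 (d : nat) (a : nat -> nat) :
  (2 <= d)%nat -> (forall i, (a i < d)%nat) ->
  INR d * val d a = INR (a 0%nat) + val d (shift 1 a).
Proof.
  intros hd ha.
  pose proof (INR_base_ge2 d hd) as h2.
  unfold val at 1. rewrite Series_incr_1 by (apply ex_series_expansion; auto).
  replace (Series (fun k => INR (a (S k)) / INR d ^ S (S k)))
    with (/ INR d * val d (shift 1 a)).
  - simpl. field. lra.
  - unfold val. rewrite <- Series_scal_l. apply Series_ext. intros n.
    unfold shift. simpl. field. split; [apply pow_nonzero|]; lra.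
Qed.

(** Shifting the digits is the map [x -> d x] modulo 1, with the integer part kept explicit. *)
Lemma val_shiftS (d : nat) (a : nat -> nat) (k : nat) :
  (2 <= d)%nat -> (forall i, (a i < d)%nat) ->
  val d (shift (S k) a) = INR d * val d (shift k a) - INR (a k).
Proof.
  intros hd ha.
  rewrite (val_shift1 d (shift k a)); auto.
  - unfold shift at 2. rewrite Nat.add_0_r.
    replace (val d (shift 1 (shift k a))) with (val d (shift (S k) a)); [ring|].
    unfold val; apply Series_ext; intros n; unfold shift.
    now replace (k + (1 + n))%nat with (S k + n)%nat by lia.
  - intros i; apply ha.
Qed.

Lemma val_shift0 (d : nat) (a : nat -> nat) : val d (shift 0 a) = val d a.
Proof. reflexivity. Qed.

Lemma val_ext (d : nat) (a b : nat -> nat) : (forall i, a i = b i) -> val d a = val d b.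
Proof. intros h; apply Series_ext; intros n; now rewrite h. Qed.

Lemma val_zeros (d : nat) : val d (fun _ => 0%nat) = 0.
Proof.
  unfold val. rewrite (Series_ext _ (fun _ => 0 * 0)).
  - rewrite (Series_scal_l 0 (fun _ => 0)). ring.
  - intros n. unfold Rdiv. simpl INR. ring.
Qed.

(** The constant sequence is invariant under the shift, so its value solves [d v = (d - 1) + v]. *)
Lemma val_tops (d : nat) : (2 <= d)%nat -> val d (fun _ => (d - 1)%nat) = 1.
Proof.
  intros hd.
  pose proof (INR_base_ge2 d hd) as h2.
  pose proof (val_shift1 d (fun _ => (d - 1)%nat) hd) as h.
  unfold shift in h. rewrite minus_INR in h by lia. simpl (INR 1) in h.
  specialize (h ltac:(intros; lia)). nra.
Qed.

Lemma val_bounds (d : nat) (a : nat -> nat) :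
  (2 <= d)%nat -> (forall i, (a i < d)%nat) -> 0 <= val d a <= 1.
Proof.
  intros hd ha.
  pose proof (INR_base_ge2 d hd) as h2.
  assert (hpos : forall i, 0 < / INR d ^ S i).
  { intros i. apply Rinv_0_lt_compat, pow_lt. lra. }
  rewrite <- (val_tops d hd), <- (val_zeros d).
  unfold val. split; apply Series_le.
  - intros n. specialize (hpos n). pose proof (pos_INR (a n)). simpl INR.
    unfold Rdiv. nra.
  - apply ex_series_expansion; auto.
  - intros n. specialize (hpos n). pose proof (pos_INR (a n)).
    assert (INR (a n) <= INR (d - 1)) by (apply le_INR; specialize (ha n); lia).
    unfold Rdiv. nra.
  - apply ex_series_expansion; auto; intros; lia.
Qed.

(** Each common leading digit cancels and divides the difference by [d]. *)
Lemma val_agree (d : nat) (k : nat) : forall a b : nat -> nat,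
  (2 <= d)%nat -> (forall i, (a i < d)%nat) -> (forall i, (b i < d)%nat) ->
  (forall i, (i < k)%nat -> a i = b i) -> Rabs (val d a - val d b) <= / INR d ^ k.
Proof.
  induction k as [|k IH]; intros a b hd ha hb hab.
  - pose proof (val_bounds d a hd ha). pose proof (val_bounds d b hd hb).
    simpl. rewrite Rinv_1. apply Rabs_le. lra.
  - pose proof (INR_base_ge2 d hd) as h2.
    pose proof (val_shift1 d a hd ha) as ea.
    pose proof (val_shift1 d b hd hb) as eb.
    specialize (IH (shift 1 a) (shift 1 b) hd (fun i => ha _) (fun i => hb _)).
    rewrite (hab 0%nat) in ea by lia.
    replace (val d a - val d b)
      with (/ INR d * (val d (shift 1 a) - val d (shift 1 b))).
    + rewrite Rabs_mult, (Rabs_pos_eq (/ INR d)) by (left; apply Rinv_0_lt_compat; lra).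
      simpl. rewrite Rinv_mult.
      apply Rmult_le_compat_l; [left; apply Rinv_0_lt_compat; lra|].
      apply IH. intros i hi. unfold shift. apply hab. lia.
    + apply (Rmult_eq_reg_l (INR d)); [|lra]. field_simplify; lra.
Qed.

(* Digits of [E] that differ do so by at least 2, which the tails (of value at most 1) cannot compensate. *)
Lemma val_separated (d : nat) (E : list nat) (k : nat) : forall a b : nat -> nat,
  (2 <= d)%nat -> (forall e, In e E -> (e < d)%nat) ->
  (forall x y, In x E -> In y E -> x <> S y) ->
  digits E a -> digits E b ->
  (exists i, (i < k)%nat /\ a i <> b i) -> / INR d ^ k <= Rabs (val d a - val d b).
Proof.
  induction k as [|k IH]; intros a b hd hE hgap ha hb [i [hi hab]]; [lia|].
  pose proof (INR_base_ge2 d hd) as h2.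
  assert (ha' : forall i, (a i < d)%nat) by (intros; apply hE, ha).
  assert (hb' : forall i, (b i < d)%nat) by (intros; apply hE, hb).
  pose proof (val_shift1 d a hd ha') as ea.
  pose proof (val_shift1 d b hd hb') as eb.
  set (va := val d (shift 1 a)) in *. set (vb := val d (shift 1 b)) in *.
  replace (val d a - val d b)
    with (/ INR d * (INR (a 0%nat) - INR (b 0%nat) + (va - vb)))
    by (apply (Rmult_eq_reg_l (INR d)); [field_simplify; lra|lra]).
  rewrite Rabs_mult, (Rabs_pos_eq (/ INR d)) by (left; apply Rinv_0_lt_compat; lra).
  simpl. rewrite Rinv_mult.
  apply Rmult_le_compat_l; [left; apply Rinv_0_lt_compat; lra|].
  destruct (Nat.eq_dec (a 0%nat) (b 0%nat)) as [e|ne].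
  - rewrite e, Rminus_diag, Rplus_0_l.
    apply IH; auto; try (intros j; unfold shift; auto).
    destruct i as [|i]; [congruence|]. exists i. split; [lia|exact hab].
  - assert (hk : / INR d ^ k <= 1).
    { rewrite <- Rinv_1. apply Rinv_le_contravar; [lra|].
      apply pow_R1_Rle; lra. }
    assert (0 <= va <= 1) by (apply val_bounds; [assumption|intros; apply ha']).
    assert (0 <= vb <= 1) by (apply val_bounds; [assumption|intros; apply hb']).
    pose proof (hgap _ _ (ha 0%nat) (hb 0%nat)).
    pose proof (hgap _ _ (hb 0%nat) (ha 0%nat)).
    assert (h : (a 0 >= b 0 + 2 \/ b 0 >= a 0 + 2)%nat) by lia.
    destruct h as [h|h]; apply le_INR in h; rewrite plus_INR in h; simpl (INR 2) in h;
      apply (Rle_trans _ 1 _ hk); unfold Rabs; destruct Rcase_abs; lra.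
Qed.

Lemma val_inj_prefix (d : nat) (E : list nat) (k : nat) (a b : nat -> nat) :
  (2 <= d)%nat -> (forall e, In e E -> (e < d)%nat) ->
  (forall x y, In x E -> In y E -> x <> S y) ->
  digits E a -> digits E b ->
  Rabs (val d a - val d b) < / INR d ^ k -> forall i, (i < k)%nat -> a i = b i.
Proof.
  intros hd hE hgap ha hb h i hi.
  destruct (Nat.eq_dec (a i) (b i)) as [e|ne]; [exact e|exfalso].
  pose proof (val_separated d E k a b hd hE hgap ha hb (ex_intro _ i (conj hi ne))). lra.
Qed.

Lemma val_inj (d : nat) (E : list nat) (a b : nat -> nat) :
  (2 <= d)%nat -> (forall e, In e E -> (e < d)%nat) ->
  (forall x y, In x E -> In y E -> x <> S y) ->
  digits E a -> digits E b -> val d a = val d b -> forall i, a i = b i.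
Proof.
  intros hd hE hgap ha hb h i.
  apply (val_inj_prefix d E (S i) a b); auto.
  rewrite h, Rminus_diag, Rabs_R0. apply Rinv_0_lt_compat, pow_lt.
  pose proof (INR_base_ge2 d hd). lra.
Qed.

(** * Rational differences of points of [J] *)

Definition occurs (w : list nat) (a : nat -> nat) (k : nat) : Prop :=
  map a (seq k (length w)) = w.

(** The first run has one extra zero: the shifts at [S k], [S k + M], [S k + 2 * M] then start with
    full runs of length [M], while the digits just before them are 0, 0 and [d - 1]. *)
Definition pattern (d M : nat) : list nat :=
  repeat 0%nat (S M) ++ repeat (d - 1)%nat M ++ repeat 0%nat M.

(** One [M] bounds both the run length and the position, so that the non-generic sequences form a
    union over [M] alone, as [Hausdorff_null_countable] requires. *)
Definition generic (d : nat) (a : nat -> nat) : Prop :=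
  forall M, exists k, (M <= k)%nat /\ occurs (pattern d M) a k.

Lemma occurs_nth (w : list nat) (a : nat -> nat) (k i : nat) :
  occurs w a k -> (i < length w)%nat -> a (k + i)%nat = nth i w 0%nat.
Proof.
  intros h hi. unfold occurs in h. rewrite <- h at 1.
  rewrite (nth_indep _ 0%nat (a 0%nat)) by (rewrite length_map, length_seq; exact hi).
  rewrite map_nth, seq_nth; auto.
Qed.

Lemma length_pattern (d M : nat) : length (pattern d M) = (3 * M + 1)%nat.
Proof. unfold pattern. rewrite !length_app, !repeat_length. lia. Qed.

Lemma occurs_pattern (d M k : nat) (a : nat -> nat) :
  occurs (pattern d M) a k ->
  (forall i, (i <= M)%nat -> a (k + i)%nat = 0%nat) /\
  (forall i, (M < i <= 2 * M)%nat -> a (k + i)%nat = (d - 1)%nat) /\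
  (forall i, (2 * M < i <= 3 * M)%nat -> a (k + i)%nat = 0%nat).
Proof.
  intros h. pose proof (length_pattern d M) as hl.
  repeat split; intros i hi; rewrite (occurs_nth _ _ _ _ h) by lia; unfold pattern.
  - rewrite app_nth1 by (rewrite repeat_length; lia). apply nth_repeat.
  - rewrite app_nth2, app_nth1; rewrite ?repeat_length; try lia.
    rewrite (nth_indep _ 0%nat (d - 1)%nat) by (rewrite repeat_length; lia).
    apply nth_repeat.
  - rewrite !app_nth2; rewrite ?repeat_length; try lia. apply nth_repeat.
Qed.

Lemma val_zero_run (d k M : nat) (a : nat -> nat) :
  (2 <= d)%nat -> (forall i, (a i < d)%nat) ->
  (forall i, (i < M)%nat -> a (k + i)%nat = 0%nat) ->
  val d (shift k a) <= / INR d ^ M.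
Proof.
  intros hd ha h.
  assert (hc : (0 < d)%nat) by lia.
  pose proof (val_agree d M (shift k a) (fun _ => 0%nat) hd (fun i => ha _)
                (fun _ => hc) h) as hv.
  rewrite val_zeros in hv. apply Rabs_le_between in hv. lra.
Qed.

Lemma val_top_run (d k M : nat) (a : nat -> nat) :
  (2 <= d)%nat -> (forall i, (a i < d)%nat) ->
  (forall i, (i < M)%nat -> a (k + i)%nat = (d - 1)%nat) ->
  1 - / INR d ^ M <= val d (shift k a).
Proof.
  intros hd ha h.
  assert (hc : (d - 1 < d)%nat) by lia.
  pose proof (val_agree d M (shift k a) (fun _ => (d - 1)%nat) hd (fun i => ha _)
                (fun _ => hc) h) as hv.
  rewrite val_tops in hv by assumption. apply Rabs_le_between in hv. lra.
Qed.

(** By injectivity the values 0 and 1 belong only to the constant sequences 0 and [d - 1], whereas a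
    generic sequence has both digits beyond any rank. *)
Lemma val_shift_generic (d : nat) (E : list nat) (a : nat -> nat) (k : nat) :
  (2 <= d)%nat -> (forall e, In e E -> (e < d)%nat) ->
  (forall x y, In x E -> In y E -> x <> S y) ->
  In 0%nat E -> In (d - 1)%nat E ->
  digits E a -> generic d a -> 0 < val d (shift k a) < 1.
Proof.
  intros hd hE hgap h0 h1 ha hgen.
  destruct (hgen (S k)) as [p [hp ho]].
  destruct (occurs_pattern _ _ _ _ ho) as [hz [ht _]].
  specialize (hz 0%nat ltac:(lia)). specialize (ht (2 * S k)%nat ltac:(lia)).
  assert (ha' : digits E (shift k a)) by (intros i; apply ha).
  pose proof (val_bounds d (shift k a) hd (fun i => hE _ (ha' i))) as hb.
  assert (h : forall c j, In c E -> (k <= j)%nat -> a j <> c ->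
                val d (shift k a) <> val d (fun _ => c)).
  { intros c j hc hj hne heq. apply hne.
    pose proof (val_inj d E (shift k a) (fun _ => c) hd hE hgap ha'
                  (fun _ => hc) heq (j - k)%nat) as hi.
    unfold shift in hi. now replace (k + (j - k))%nat with j in hi by lia. }
  pose proof (h 0%nat _ h0 (Nat.le_trans k p (p + 2 * S k) ltac:(lia) ltac:(lia))
                ltac:(lia)) as n0.
  pose proof (h (d - 1)%nat (p + 0)%nat h1 ltac:(lia) ltac:(lia)) as n1.
  rewrite val_zeros in n0. rewrite val_tops in n1 by assumption. lra.
Qed.

(** Pigeonhole on the residues modulo [q]; after the first repetition, multiplying by further powers
    of [d] propagates it. *)
Lemma power_periodic (d q : Z) : (0 < q)%Z ->
  exists j m : nat, (0 < m)%nat /\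
    forall k t : nat, (j <= k)%nat ->
      (q | d ^ Z.of_nat (k + m * t) - d ^ Z.of_nat k)%Z.
Proof.
  intros hq.
  assert (hrep : exists j m : nat, (0 < m)%nat /\
            (d ^ Z.of_nat (j + m) mod q = d ^ Z.of_nat j mod q)%Z).
  (* Without a repetition, [q + 1] distinct residues would lie among [q] values. *)
  { apply NNPP. intros hn.
    set (f := fun i : nat => Z.to_nat (d ^ Z.of_nat i mod q)).
    set (n := Z.to_nat q).
    assert (hnd : NoDup (map f (seq 0 (S n)))).
    { apply NoDup_map_NoDup_ForallPairs; [|apply seq_NoDup].
      intros x y _ _ hxy. unfold f in hxy.
      apply Z2Nat.inj in hxy; try (apply Z.mod_pos_bound; exact hq).
      destruct (Nat.lt_trichotomy x y) as [l|[l|l]]; [exfalso| exact l|exfalso];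
        apply hn.
      - exists x, (y - x)%nat. split; [lia|].
        now replace (x + (y - x))%nat with y by lia.
      - exists y, (x - y)%nat. split; [lia|].
        now replace (y + (x - y))%nat with x by lia. }
    assert (hinc : incl (map f (seq 0 (S n))) (seq 0 n)).
    { intros x hx. apply in_map_iff in hx. destruct hx as [i [<- _]].
      apply in_seq. unfold f, n.
      pose proof (Z.mod_pos_bound (d ^ Z.of_nat i) q hq). lia. }
    pose proof (NoDup_incl_length hnd hinc) as hlen.
    rewrite length_map, !length_seq in hlen. lia. }
  destruct hrep as [j [m [hm he]]]. exists j, m. split; [exact hm|].
  intros k t hk.
  assert (h1 : (q | d ^ Z.of_nat (j + m) - d ^ Z.of_nat j)%Z).
  { apply Z.mod_divide; [lia|]. rewrite Zminus_mod, he, Z.sub_diag. reflexivity. }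
  induction t as [|t IH].
  - rewrite Nat.mul_0_r, Nat.add_0_r, Z.sub_diag. apply Z.divide_0_r.
  - replace (d ^ Z.of_nat (k + m * S t) - d ^ Z.of_nat k)%Z
      with ((d ^ Z.of_nat (j + m) - d ^ Z.of_nat j) * d ^ Z.of_nat (k - j + m * t)
            + (d ^ Z.of_nat (k + m * t) - d ^ Z.of_nat k))%Z.
    + apply Z.divide_add_r; [apply Z.divide_mul_l|]; assumption.
    + replace (k + m * S t)%nat with (j + m + (k - j + m * t))%nat by lia.
      replace (k + m * t)%nat with (j + (k - j + m * t))%nat by lia.
      rewrite !(Nat2Z.inj_add _ (k - j + m * t)), !Z.pow_add_r by lia. ring.
Qed.

Lemma mul_lt_unique (q c n : Z) :
  (0 < q)%Z -> ((n - 1) * q < c * q < (n + 1) * q)%Z -> c = n.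
Proof. nia. Qed.

(* If [val v - val u = p / q], the [k]-th shifts of [v] and [u] differ by [numer k / q]. *)
Fixpoint numer (d : nat) (u v : nat -> nat) (p q : Z) (k : nat) : Z :=
  match k with
  | O => p
  | S k => Z.of_nat d * numer d u v p q k - q * (Z.of_nat (v k) - Z.of_nat (u k))
  end.

Lemma numer_spec (d : nat) (u v : nat -> nat) (p q : Z) (k : nat) :
  (2 <= d)%nat -> (forall i, (u i < d)%nat) -> (forall i, (v i < d)%nat) ->
  (0 < q)%Z -> val d v - val d u = IZR p / IZR q ->
  IZR q * (val d (shift k v) - val d (shift k u)) = IZR (numer d u v p q k).
Proof.
  intros hd hu hv hq h. apply IZR_lt in hq.
  induction k as [|k IH].
  - rewrite !val_shift0, h. simpl. field. lra.
  - rewrite !val_shiftS by assumption. simpl numer.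
    rewrite minus_IZR, !mult_IZR, minus_IZR, <- !INR_IZR_INZ, <- IH. ring.
Qed.

(** Modulo [q] the recursion of [numer] is just multiplication by [d]. *)
Lemma numer_mod (d : nat) (u v : nat -> nat) (p q : Z) (k : nat) :
  (q | numer d u v p q k - Z.of_nat d ^ Z.of_nat k * p)%Z.
Proof.
  induction k as [|k IH].
  (* Here [simpl] has turned [1 * p] into a match on [p]. *)
  - simpl. replace (p - match p with 0 => 0 | Z.pos y' => Z.pos y' | Z.neg y' => Z.neg y' end)%Z
      with 0%Z by (destruct p; lia). apply Z.divide_0_r.
  - rewrite Nat2Z.inj_succ, Z.pow_succ_r by lia. simpl numer.
    destruct IH as [c hc].
    exists (Z.of_nat d * c - (Z.of_nat (v k) - Z.of_nat (u k)))%Z. nia.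
Qed.

(** The shift of the generic [u] has its value strictly inside (0, 1) and that of [v] lies in
    [0, 1], so an integral difference is 0 and injectivity applies. *)
Lemma integral_shift_difference (d : nat) (E : list nat) (u v : nat -> nat) (k : nat) (z : Z) :
  (2 <= d)%nat -> (forall e, In e E -> (e < d)%nat) ->
  (forall x y, In x E -> In y E -> x <> S y) ->
  In 0%nat E -> In (d - 1)%nat E ->
  digits E u -> digits E v -> generic d u ->
  val d (shift k v) - val d (shift k u) = IZR z ->
  forall i, (k <= i)%nat -> v i = u i.
Proof.
  intros hd hE hgap h0 h1 hu hv hgen hz i hi.
  pose proof (val_shift_generic d E u k hd hE hgap h0 h1 hu hgen) as bu.
  pose proof (val_bounds d (shift k v) hd (fun j => hE _ (hv _))) as bv.
  assert (hlt : -1 < IZR z < 1) by lra.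
  destruct hlt as [l1 l2]. apply lt_IZR in l1, l2.
  assert (z = 0%Z) by lia. subst z.
  pose proof (val_inj d E (shift k v) (shift k u) hd hE hgap
                (fun j => hv _) (fun j => hu _) ltac:(lra) (i - k)%nat) as h.
  unfold shift in h. now replace (k + (i - k))%nat with i in h by lia.
Qed.

(* Along an occurrence of [0^(M+1) (d-1)^M 0^M] in [u] at [k], with [M] a period of the powers of
   [d] modulo [q], a run of zeros forces a nonnegative difference of the shifts and a run of
   [d-1] a nonpositive one. Unless that difference is an integer, the digits of [v] at [k],
   [k+M], [k+2M] are [c], [c+1], [c-1] modulo [d], which the gap condition excludes. *)
Lemma rational_difference_shift (d : nat) (E : list nat) (u v : nat -> nat) (p q : Z) :
  (2 <= d)%nat -> (forall e, In e E -> (e < d)%nat) ->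
  (forall x y, In x E -> In y E -> x <> S y) ->
  In 0%nat E -> In (d - 1)%nat E ->
  digits E u -> digits E v -> generic d u ->
  (0 < q)%Z -> val d v - val d u = IZR p / IZR q ->
  exists k, forall i, (k <= i)%nat -> v i = u i.
Proof.
  intros hd hE hgap h0 h1 hu hv hgen hq h.
  assert (hu' : forall i, (u i < d)%nat) by (intros; apply hE, hu).
  assert (hv' : forall i, (v i < d)%nat) by (intros; apply hE, hv).
  pose proof (INR_base_ge2 d hd) as h2.
  assert (hqR : 0 < IZR q) by (apply IZR_lt; exact hq).
  destruct (power_periodic (Z.of_nat d) q hq) as [j [m [hm hper]]].
  (* This [t] makes the multiple [M] of [m] exceed both [j], so that positions from [M] on are in
     the periodic range, and [q], so that [q * d^-M < 1]. *)
  set (t := (j + Z.to_nat q + 1)%nat).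
  set (M := (m * t)%nat).
  assert (hMt : (t <= M)%nat) by (unfold M; nia).
  destruct (hgen M) as [k [hk ho]].
  destruct (occurs_pattern _ _ _ _ ho) as [hA [hB hC]].
  set (z := numer d u v p q).
  assert (hz : forall i, IZR q * (val d (shift i v) - val d (shift i u)) = IZR (z i))
    by (intros i; apply numer_spec; assumption).
  assert (hcong : forall i s, (j <= i)%nat -> (q | z (i + m * s)%nat - z i)%Z).
  { intros i s hi. unfold z.
    destruct (numer_mod d u v p q i) as [c1 e1].
    destruct (numer_mod d u v p q (i + m * s)) as [c2 e2].
    destruct (hper i s hi) as [c3 e3].
    exists (c2 - c1 + c3 * p)%Z.
    replace (numer d u v p q (i + m * s))
      with (c2 * q + Z.of_nat d ^ Z.of_nat (i + m * s) * p)%Z by lia.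
    replace (numer d u v p q i) with (c1 * q + Z.of_nat d ^ Z.of_nat i * p)%Z by lia.
    replace (Z.of_nat d ^ Z.of_nat (i + m * s))%Z
      with (c3 * q + Z.of_nat d ^ Z.of_nat i)%Z by lia.
    ring. }
  assert (hbnd : forall i, (- q <= z i <= q)%Z).
  { intros i.
    pose proof (val_bounds d (shift i u) hd (fun j => hu' _)).
    pose proof (val_bounds d (shift i v) hd (fun j => hv' _)).
    specialize (hz i). split; apply le_IZR; rewrite ?opp_IZR; nra. }
  assert (hsmall : IZR q * / INR d ^ M < 1).
  { assert (hp : INR M < INR d ^ M).
    { rewrite <- pow_INR. apply lt_INR. apply Nat.pow_gt_lin_r. lia. }
    assert (hqM : IZR q <= INR M).
    { rewrite INR_IZR_INZ. apply IZR_le. unfold t in hMt. lia. }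
    apply (Rmult_lt_reg_r (INR d ^ M)); [apply pow_lt; lra|].
    field_simplify; [lra|apply pow_nonzero; lra]. }
  (* In a zero run the shift of [u] is at most [d^-M], so the integer [z i] exceeds -1; the runs of
     [d - 1] are symmetric. *)
  assert (hnn : forall i, (forall l, (l < M)%nat -> u (i + l)%nat = 0%nat) -> (0 <= z i)%Z).
  { intros i hi. pose proof (val_zero_run d i M u hd hu' hi).
    pose proof (val_bounds d (shift i v) hd (fun j => hv' _)).
    specialize (hz i).
    cut (-1 < z i)%Z; [lia|]. apply lt_IZR. nra. }
  assert (hnp : forall i, (forall l, (l < M)%nat -> u (i + l)%nat = (d - 1)%nat) -> (z i <= 0)%Z).
  { intros i hi. pose proof (val_top_run d i M u hd hu' hi).
    pose proof (val_bounds d (shift i v) hd (fun j => hv' _)).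
    specialize (hz i).
    cut (z i < 1)%Z; [lia|]. apply lt_IZR. nra. }
  assert (s0 : (0 <= z (S k))%Z).
  { apply hnn. intros l hl. replace (S k + l)%nat with (k + (1 + l))%nat by lia.
    apply hA. lia. }
  assert (s1 : (z (S k + M)%nat <= 0)%Z).
  { apply hnp. intros l hl. replace (S k + M + l)%nat with (k + (M + 1 + l))%nat by lia.
    apply hB. lia. }
  assert (s2 : (0 <= z (S k + 2 * M)%nat)%Z).
  { apply hnn. intros l hl.
    replace (S k + 2 * M + l)%nat with (k + (2 * M + 1 + l))%nat by lia.
    apply hC. lia. }
  assert (tM2 : (m * (2 * t) = 2 * M)%nat) by (unfold M; lia).
  destruct (hcong k t ltac:(lia)) as [al ea].
  destruct (hcong k (2 * t)%nat ltac:(lia)) as [be eb].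
  destruct (hcong (S k) t ltac:(lia)) as [al' ea'].
  destruct (hcong (S k) (2 * t)%nat ltac:(lia)) as [be' eb'].
  rewrite tM2 in eb, eb'. fold M in ea, ea'.
  assert (b0 := hbnd (S k)). assert (b1 := hbnd (S k + M)%nat).
  assert (b2 := hbnd (S k + 2 * M)%nat).
  (* At the extremes 0 and [q] of its range, [z (S k)] makes the difference of the shifts an
     integer. *)
  destruct (Z.eq_dec (z (S k)) 0) as [hz0|hz0].
  { exists (S k). apply (integral_shift_difference d E u v (S k) 0); auto.
    specialize (hz (S k)). rewrite hz0 in hz. nra. }
  destruct (Z.eq_dec (z (S k)) q) as [hzq|hzq].
  { exists (S k). apply (integral_shift_difference d E u v (S k) 1); auto.
    specialize (hz (S k)). rewrite hzq in hz. nra. }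
  exfalso.
  (* With [0 < z (S k) < q], the congruent number [z (S k + M)] in [[-q, 0]] must be [z (S k) - q],
     and [z (S k + 2 * M)] in [[0, q]] must be [z (S k)]. *)
  assert (al' = (-1)%Z) by (apply (mul_lt_unique q); lia).
  assert (be' = 0%Z) by (apply (mul_lt_unique q); lia). subst al' be'.
  assert (d0 := hA 0%nat ltac:(lia)). rewrite Nat.add_0_r in d0.
  assert (d1 := hA M ltac:(lia)).
  assert (d2 := hB (2 * M)%nat ltac:(lia)).
  assert (r0 : z (S k) = (Z.of_nat d * z k - q * (Z.of_nat (v k) - Z.of_nat (u k)))%Z)
    by reflexivity.
  assert (r1 : z (S k + M)%nat = (Z.of_nat d * z (k + M)%nat
     - q * (Z.of_nat (v (k + M)%nat) - Z.of_nat (u (k + M)%nat)))%Z) by reflexivity.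
  assert (r2 : z (S k + 2 * M)%nat = (Z.of_nat d * z (k + 2 * M)%nat
     - q * (Z.of_nat (v (k + 2 * M)%nat) - Z.of_nat (u (k + 2 * M)%nat)))%Z) by reflexivity.
  rewrite d0 in r0. rewrite d1 in r1. rewrite d2 in r2.
  (* Subtracting the recursions at [k] and at the later position and dividing by [q] relates the
     digits of [v]. *)
  assert (f1 : (Z.of_nat (v (k + M)%nat) = Z.of_nat (v k) + Z.of_nat d * al + 1)%Z).
  { apply (Z.mul_reg_l _ _ q); [lia|].
    replace (z (k + M)%nat) with (z k + al * q)%Z in r1 by lia. lia. }
  assert (f2 : (Z.of_nat (v (k + 2 * M)%nat)
                = Z.of_nat d - 1 + Z.of_nat (v k) + Z.of_nat d * be)%Z).
  { apply (Z.mul_reg_l _ _ q); [lia|].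
    replace (z (k + 2 * M)%nat) with (z k + be * q)%Z in r2 by lia. lia. }
  assert (v0 := hv' k). assert (v1 := hv' (k + M)%nat). assert (v2 := hv' (k + 2 * M)%nat).
  clear - hd hgap hv h1 f1 f2 v0 v1 v2.
  (* Without wraparound [v k] and [v (k + M)] are neighbours. With it, [v k = d - 1], which forces
     [v (k + 2 * M) = d - 2], a neighbour of [d - 1]. *)
  destruct (Z.eq_dec al 0) as [-> | hal].
  - apply (hgap _ _ (hv (k + M)%nat) (hv k)). lia.
  - assert (al = (-1)%Z) by (apply (mul_lt_unique (Z.of_nat d)); nia). subst al.
    assert (be = (-1)%Z) by (apply (mul_lt_unique (Z.of_nat d)); lia). subst be.
    apply (hgap _ _ h1 (hv (k + 2 * M)%nat)). lia.
Qed.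

Lemma val_prefix (d : nat) (a : nat -> nat) (k : nat) :
  (2 <= d)%nat -> (forall i, (a i < d)%nat) ->
  exists z : Z, INR d ^ k * val d a = IZR z + val d (shift k a).
Proof.
  intros hd ha. induction k as [|k [z hz]].
  - exists 0%Z. simpl. rewrite val_shift0. ring.
  - exists (Z.of_nat d * z + Z.of_nat (a k))%Z.
    rewrite val_shiftS by assumption.
    rewrite plus_IZR, mult_IZR, <- !INR_IZR_INZ. simpl pow.
    rewrite Rmult_assoc, hz. ring.
Qed.

(** A common tail from rank [K] makes [d^K * p / q] an integer; [p] and [q] being coprime, [q]
    divides [d^K], and primality of [d] makes [q] a power of [d]. *)
Lemma rational_difference (d : nat) (E : list nat) (u v : nat -> nat) (p q : Z) :
  prime (Z.of_nat d) -> (forall e, In e E -> (e < d)%nat) ->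
  (forall x y, In x E -> In y E -> x <> S y) ->
  In 0%nat E -> In (d - 1)%nat E ->
  digits E u -> digits E v -> generic d u ->
  (0 < q)%Z -> Z.gcd p q = 1%Z -> val d v - val d u = IZR p / IZR q ->
  exists k, IZR q = INR d ^ k /\ forall i, (k <= i)%nat -> v i = u i.
Proof.
  intros hprime hE hgap h0 h1 hu hv hgen hq hpq h.
  assert (hd : (2 <= d)%nat) by (apply prime_ge_2 in hprime; lia).
  assert (hu' : forall i, (u i < d)%nat) by (intros; apply hE, hu).
  assert (hv' : forall i, (v i < d)%nat) by (intros; apply hE, hv).
  assert (hqR : 0 < IZR q) by (apply IZR_lt; exact hq).
  destruct (rational_difference_shift d E u v p q) as [K hK]; auto.
  destruct (val_prefix d u K hd hu') as [zu eu].
  destruct (val_prefix d v K hd hv') as [zv ev].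
  assert (e : val d (shift K v) = val d (shift K u))
    by (apply val_ext; intros i; apply hK; lia).
  assert (hdiv : (q | Z.of_nat d ^ Z.of_nat K)%Z).
  { apply (Gauss _ p).
    - exists (zv - zu)%Z. apply eq_IZR.
      rewrite !mult_IZR, minus_IZR, <- pow_IZR, <- INR_IZR_INZ.
      replace (IZR zv - IZR zu) with (INR d ^ K * (val d v - val d u)) by lra.
      rewrite h. field. lra.
    - apply Zgcd_1_rel_prime. rewrite Z.gcd_comm. exact hpq. }
  apply Zpow_facts.Zdivide_power_2 in hdiv; try lia; auto.
  destruct hdiv as [k' hk'].
  (* A negative exponent would make the power, hence [q], equal to 0. *)
  assert (0 <= k')%Z.
  { destruct (Z_lt_le_dec k' 0); [|assumption]. rewrite Z.pow_neg_r in hk' by assumption. lia. }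
  exists (Z.to_nat k').
  assert (hqk : IZR q = INR d ^ Z.to_nat k').
  { rewrite hk', INR_IZR_INZ, pow_IZR. now rewrite Z2Nat.id. }
  split; [exact hqk|].
  (* Since [q = d^k'], the shifts at rank [k'] already differ by an integer, which improves [K] to
     [k']. *)
  destruct (val_prefix d u (Z.to_nat k') hd hu') as [yu fu].
  destruct (val_prefix d v (Z.to_nat k') hd hv') as [yv fv].
  apply (integral_shift_difference d E u v _ (p - yv + yu)); auto.
  rewrite plus_IZR, minus_IZR.
  assert (IZR p = INR d ^ Z.to_nat k' * (val d v - val d u)).
  { rewrite h, <- hqk. field. lra. }
  lra.
Qed.

Lemma badly_approximable_criterion
  (d : nat) (E : list nat) (u b : nat -> nat) (m : nat) (K : R) :
  prime (Z.of_nat d) -> (forall e, In e E -> (e < d)%nat) ->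
  (forall x y, In x E -> In y E -> x <> S y) ->
  In 0%nat E -> In (d - 1)%nat E ->
  digits E u -> digits E b -> generic d u -> (0 < m)%nat -> 0 < K ->
  (forall i, (i mod m = 0)%nat -> b i <> u i) ->
  badly_intrinsically_approximable
    (translate (Jset d E) (val d u)) (fun _ => K) (val d b - val d u).
Proof.
  intros hprime hE hgap h0 h1 hu hb hgen hm hK hbu.
  assert (hd : (2 <= d)%nat) by (apply prime_ge_2 in hprime; lia).
  pose proof (INR_base_ge2 d hd) as h2.
  split.
  { exists (val d b). split; [|reflexivity]. exists b. split; [exact hb|].
    apply infinite_sum_val; auto. }
  assert (hdm : 0 < / INR d ^ m) by (apply Rinv_0_lt_compat, pow_lt; lra).
  (* With this choice [eps * K] is half of [d^-m], so the separation bound excludes every rational: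
     the list below is empty. *)
  exists (/ INR d ^ m / (2 * K)). split.
  { apply Rdiv_lt_0_compat; lra. }
  intros [_ hinf]. apply hinf. exists nil.
  intros p q [hq [hpq [[t [[v [hv hvt]] e]] happ]]]. exfalso.
  apply val_infinite_sum in hvt. subst t.
  destruct (rational_difference d E u v p q) as [k [eq hk]]; auto.
  (* The least multiple of [m] that is at least [k]. *)
  set (i := (m * ((k + m - 1) / m))%nat).
  pose proof (Nat.div_mod_eq (k + m - 1) m) as hdiv.
  pose proof (Nat.mod_upper_bound (k + m - 1) m ltac:(lia)) as hmod.
  assert (hi : (k <= i < k + m)%nat) by (unfold i; lia).
  assert (hne : b i <> v i).
  { rewrite (hk i) by lia. apply hbu. unfold i. rewrite Nat.mul_comm.
    apply Nat.Div0.mod_mul. }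
  pose proof (val_separated d E (k + m) b v hd hE hgap hb hv
                (ex_intro _ i (conj (proj2 hi) hne))) as hsep.
  rewrite e, eq in happ.
  replace (val d b - val d u - (val d v - val d u))
    with (val d b - val d v) in happ by ring.
  assert (hdk : 0 < / INR d ^ k) by (apply Rinv_0_lt_compat, pow_lt; lra).
  rewrite pow_add, Rinv_mult in hsep.
  replace (/ INR d ^ m / (2 * K) * K / INR d ^ k)
    with (/ INR d ^ k * / INR d ^ m / 2) in happ
    by (field; repeat split; try apply pow_nonzero; lra).
  assert (0 < / INR d ^ k * / INR d ^ m) by nra.
  lra.
Qed.

(** * Mass distribution *)

Definition lsum {A : Type} (f : A -> R) (l : list A) : R :=
  fold_right (fun x r => f x + r) 0 l.

Lemma lsum_cons {A : Type} (f : A -> R) (x : A) (l : list A) :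
  lsum f (x :: l) = f x + lsum f l.
Proof. reflexivity. Qed.

Lemma lsum_ge_const {A : Type} (f : A -> R) (c : R) (l : list A) :
  (forall x, In x l -> c <= f x) -> INR (length l) * c <= lsum f l.
Proof.
  induction l as [|x l IH]; intros h; simpl length; simpl lsum.
  - simpl. lra.
  - rewrite S_INR. pose proof (h x (or_introl eq_refl)).
    specialize (IH (fun y hy => h y (or_intror hy))). lra.
Qed.

Lemma lsum_const {A : Type} (c : R) (l : list A) :
  lsum (fun _ => c) l = INR (length l) * c.
Proof.
  induction l as [|x l IH]; simpl length; simpl lsum; [simpl; ring|].
  rewrite S_INR, IH. ring.
Qed.

Lemma lsum_sum_f_R0 {A : Type} (f : nat -> A -> R) (l : list A) (N : nat) :
  lsum (fun x => sum_f_R0 (fun n => f n x) N) l = sum_f_R0 (fun n => lsum (f n) l) N.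
Proof.
  induction l as [|x l IH]; simpl lsum.
  - induction N as [|N IHN]; simpl; [reflexivity|]. rewrite <- IHN. ring.
  - rewrite IH, <- plus_sum. reflexivity.
Qed.

Lemma lsum_if_eq_le (c : nat) (w : R) (l : list nat) :
  NoDup l -> 0 <= w -> lsum (fun e => if (c =? e)%nat then w else 0) l <= w.
Proof.
  intros hl hw.
  assert (h0 : forall l, ~ In c l -> lsum (fun e => if (c =? e)%nat then w else 0) l = 0).
  { clear. induction l as [|x l IH]; intros h; [reflexivity|]. rewrite lsum_cons.
    destruct (Nat.eqb_spec c x) as [e|_]; [subst; exfalso; apply h; left; reflexivity|].
    rewrite IH; [ring|]. intros hc; apply h; right; exact hc. }
  induction hl as [|x l hx hl IH]; [exact hw|]. rewrite lsum_cons.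
  destruct (Nat.eqb_spec c x) as [e|_].
  - subst x. rewrite (h0 l hx). lra.
  - lra.
Qed.

Lemma common_bound {A : Type} (P : A -> nat -> Prop) (l : list A) :
  (forall x n m, (n <= m)%nat -> P x n -> P x m) ->
  (forall x, In x l -> exists n, P x n) -> exists n, forall x, In x l -> P x n.
Proof.
  intros hmono. induction l as [|x l IH]; intros h.
  - exists 0%nat. intros y [].
  - destruct IH as [n hn]; [intros y hy; apply h; right; exact hy|].
    destruct (h x (or_introl eq_refl)) as [m hm].
    exists (max n m). intros y [<-|hy].
    + apply (hmono _ m); [lia|exact hm].
    + apply (hmono _ n); [lia|apply hn; exact hy].
Qed.

Lemma sum_f_R0_mono (f : nat -> R) (n m : nat) :
  (forall i, 0 <= f i) -> (n <= m)%nat -> sum_f_R0 f n <= sum_f_R0 f m.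
Proof.
  intros hf h. induction h as [|m h IH]; [lra|]. simpl. specialize (hf (S m)). lra.
Qed.

(** For the product of the uniform measures on the sets [F i], this is the conditional mass of a
    cylinder of rank [j + r] inside the one of rank [j] containing it. *)
Fixpoint mass (F : nat -> list nat) (j r : nat) : R :=
  match r with
  | O => 1
  | S r => / INR (length (F j)) * mass F (S j) r
  end.

Lemma mass_pos (F : nat -> list nat) (j r : nat) :
  (forall i, F i <> nil) -> 0 < mass F j r.
Proof.
  intros hF. revert j. induction r as [|r IH]; intros j; simpl; [lra|].
  apply Rmult_lt_0_compat; [|apply IH].
  apply Rinv_0_lt_compat. specialize (hF j).
  destruct (F j); [congruence|]. simpl length. rewrite S_INR. pose proof (pos_INR (length l)). lra.
Qed.

Lemma mass_S_r (F : nat -> list nat) (j r : nat) :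
  mass F j (S r) = mass F j r * / INR (length (F (j + r)%nat)).
Proof.
  revert j. induction r as [|r IH]; intros j.
  - simpl. rewrite Nat.add_0_r. ring.
  - change (mass F j (S (S r))) with (/ INR (length (F j)) * mass F (S j) (S r)).
    rewrite IH. simpl mass. replace (j + S r)%nat with (S j + r)%nat by lia. ring.
Qed.

(* Among the cylinders [(c n, k n)], those flagged [alive n] are compatible with the first [j]
   digits chosen; the sum below is then their total conditional mass. *)
Definition small_remainder (F : nat -> list nat) (k : nat -> nat) (j : nat)
  (alive : nat -> bool) : Prop :=
  exists B, B < 1 /\
    forall N, sum_f_R0 (fun n => if alive n then mass F j (k n - j) else 0) N <= B.

(** A cylinder of rank at most [j] does not constrain digit [j], hence the first disjunct. *)
Definition survive (c : nat -> nat -> nat) (k : nat -> nat) (j e : nat)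
  (alive : nat -> bool) (n : nat) : bool :=
  (alive n && ((k n <=? j)%nat || (c n j =? e)%nat))%bool.

(* The conditional mass at a node is the average over its children, hence some child does not increase it. *)
Lemma small_remainder_step (F : nat -> list nat) (c : nat -> nat -> nat) (k : nat -> nat)
  (j : nat) (alive : nat -> bool) :
  (forall i, NoDup (F i)) -> (forall i, F i <> nil) ->
  small_remainder F k j alive ->
  exists e, In e (F j) /\ small_remainder F k (S j) (survive c k j e alive).
Proof.
  intros hnd hne [B [hB hsum]].
  apply NNPP. intros hno.
  set (g := fun n e => if survive c k j e alive n then mass F (S j) (k n - S j) else 0).
  assert (hg : forall n e, 0 <= g n e).
  { intros n e. unfold g. destruct (survive _ _ _ _ _ _); [|lra].
    left; apply mass_pos; exact hne. }
  (* If every child fails, each exceeds the threshold [(1 + B) / 2], strictly between [B] and 1, at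
     some partial sum; monotonicity gives one [N] for the finitely many children. *)
  destruct (common_bound (fun e N => (1 + B) / 2 <= sum_f_R0 (fun n => g n e) N) (F j))
    as [N hN].
  - intros e n m hnm h. apply (Rle_trans _ _ _ h). apply sum_f_R0_mono; auto.
  - intros e he. apply NNPP. intros hcon. apply hno. exists e. split; [exact he|].
    exists ((1 + B) / 2). split; [lra|]. intros N.
    destruct (Rle_lt_dec (sum_f_R0 (fun n => g n e) N) ((1 + B) / 2)) as [h|h]; [exact h|].
    exfalso. apply hcon. exists N. lra.
  - pose proof (lsum_ge_const _ _ _ hN) as h1.
    rewrite lsum_sum_f_R0 in h1.
    assert (hpos : 0 < INR (length (F j))).
    { specialize (hne j). apply lt_0_INR. destruct (F j); [congruence|simpl; lia]. }
    assert (h2 : sum_f_R0 (fun n => lsum (g n) (F j)) N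
                 <= sum_f_R0 (fun n => (if alive n then mass F j (k n - j) else 0)
                                       * INR (length (F j))) N).
    (* A cylinder of rank at most [j] counts 1 at every child; a longer one survives at no child
       other than [c n j]. *)
    { apply sum_Rle. intros n _. unfold g, survive.
      destruct (alive n); simpl.
      - destruct (Nat.leb_spec (k n) j) as [hk|hk]; simpl.
        + replace (k n - j)%nat with 0%nat by lia. replace (k n - S j)%nat with 0%nat by lia.
          simpl. rewrite lsum_const. lra.
        + replace (k n - j)%nat with (S (k n - S j)) by lia. simpl mass.
          apply (Rle_trans _ (mass F (S j) (k n - S j))).
          * apply lsum_if_eq_le; [apply hnd|]. left; apply mass_pos; exact hne.
          * right. field. lra.
      - rewrite lsum_const. lra. }
    rewrite <- scal_sum in h2. specialize (hsum N).
    set (T := sum_f_R0 _ N) in hsum. fold T in h2. nra.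
Qed.

Lemma mass_distribution (F : nat -> list nat) (c : nat -> nat -> nat) (k : nat -> nat) (B : R) :
  (forall i, NoDup (F i)) -> (forall i, F i <> nil) -> B < 1 ->
  (forall N, sum_f_R0 (fun n => mass F 0 (k n)) N <= B) ->
  exists a : nat -> nat, (forall i, In (a i) (F i)) /\
    forall n, exists i, (i < k n)%nat /\ a i <> c n i.
Proof.
  intros hnd hne hB hsum.
  (* The invariant stands inside the existential so that the choice of a child is a total function;
     0 is the default. *)
  assert (hch : forall s : nat * (nat -> bool), exists e,
    small_remainder F k (fst s) (snd s) ->
    In e (F (fst s)) /\ small_remainder F k (S (fst s)) (survive c k (fst s) e (snd s))).
  { intros [j al]; simpl.
    destruct (classic (small_remainder F k j al)) as [h|h].
    - destruct (small_remainder_step F c k j al hnd hne h) as [e he]. exists e; auto.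
    - exists 0%nat. tauto. }
  set (ch := fun j al => proj1_sig (constructive_indefinite_description _ (hch (j, al)))).
  set (st := fix st j := match j with
    | O => fun _ : nat => true
    | S j => survive c k j (ch j (st j)) (st j) end).
  assert (hinv : forall j, small_remainder F k j (st j)).
  { induction j as [|j IH].
    - exists B. split; [exact hB|]. intros N.
      rewrite (sum_eq _ (fun n => mass F 0 (k n))); auto.
      intros i _. simpl. now rewrite Nat.sub_0_r.
    - apply (proj2_sig (constructive_indefinite_description _ (hch (j, st j)))). exact IH. }
  exists (fun j => ch j (st j)). split.
  - intros j. apply (proj2_sig (constructive_indefinite_description _ (hch (j, st j)))), hinv.
  - intros n. apply NNPP. intros hno.
    (* A branch inside cylinder [n] would keep it alive down to rank [k n], where it alone has
       conditional mass 1. *)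
    assert (hag : forall i, (i < k n)%nat -> ch i (st i) = c n i).
    { intros i hi. apply NNPP. intros h. apply hno. exists i. auto. }
    assert (hal : forall j, (j <= k n)%nat -> st j n = true).
    { induction j as [|j IH]; intros hj; [reflexivity|].
      simpl. unfold survive. rewrite IH by lia. rewrite hag by lia.
      rewrite Nat.eqb_refl, Bool.orb_true_r. reflexivity. }
    destruct (hinv (k n)) as [B' [hB' h]]. specialize (h n).
    assert (h1 : 1 <= sum_f_R0 (fun i => if st (k n) i then mass F (k n) (k i - k n) else 0) n).
    { set (f := fun i => _). fold f.
      assert (hf : forall i, 0 <= f i).
      { intros i. unfold f. destruct (st (k n) i); [left; apply mass_pos; exact hne|lra]. }
      assert (hn : f n = 1).
      { unfold f. rewrite hal by lia. rewrite Nat.sub_diag. reflexivity. }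
      destruct n as [|n]; simpl; rewrite hn; [lra|].
      pose proof (cond_pos_sum f n hf). lra. }
    lra.
Qed.

Lemma base_scale (d : nat) (D : R) : (2 <= d)%nat -> 0 < D < 1 ->
  exists k : nat, / INR d ^ S k <= D < / INR d ^ k.
Proof.
  intros hd hD. pose proof (INR_base_ge2 d hd) as h2.
  assert (hex : exists n, / INR d ^ n <= D).
  { destruct (Pow_x_infinity (INR d) ltac:(rewrite Rabs_pos_eq; lra) (/ D)) as [n hn].
    exists n. specialize (hn n (le_n n)).
    rewrite Rabs_pos_eq in hn by (apply pow_le; lra).
    rewrite <- (Rinv_inv D). apply Rinv_le_contravar; [apply Rinv_0_lt_compat; lra|lra]. }
  destruct hex as [n hn]. revert hn. induction n as [|n IH]; intros hn.
  - simpl in hn. lra.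
  - destruct (Rle_lt_dec (/ INR d ^ n) D) as [h|h]; [apply IH, h|].
    exists n. split; assumption.
Qed.

(* A set of diameter less than [d^-k] meets the Cantor set in a single cylinder of rank [k]. *)
Lemma cantor_not_null (d : nat) (E : list nat) (F : nat -> list nat) (X : R -> Prop) (s C : R) :
  (2 <= d)%nat -> (forall e, In e E -> (e < d)%nat) ->
  (forall x y, In x E -> In y E -> x <> S y) ->
  (forall i, NoDup (F i)) -> (forall i, F i <> nil) -> (forall i, incl (F i) E) ->
  (forall a, (forall i, In (a i) (F i)) -> X (val d a)) ->
  0 < C -> 0 <= s -> (forall k, mass F 0 k <= C * Rpower (/ INR d ^ k) s) ->
  ~ Hausdorff_null s X.
Proof.
  intros hd hE hgap hnd hne hinc hX hC hs hmass hnull.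
  pose proof (INR_base_ge2 d hd) as h2.
  (* Chosen so that the cylinders replacing the cover have total mass at most 1/2. *)
  set (eps := / (2 * C * Rpower (INR d) s)).
  assert (hds : 0 < Rpower (INR d) s) by apply exp_pos.
  assert (heps : 0 < eps) by (apply Rinv_0_lt_compat; nra).
  destruct (hnull 1 eps Rlt_0_1 heps) as [U [D [l [hcov [hD [hdiam [hsum hl]]]]]]].
  assert (hk : forall n, exists k, / INR d ^ S k <= D n < / INR d ^ k)
    by (intros n; apply base_scale; auto).
  set (k := fun n => proj1_sig (constructive_indefinite_description _ (hk n))).
  assert (hk' : forall n, / INR d ^ S (k n) <= D n < / INR d ^ k n)
    by (intros n; apply (proj2_sig (constructive_indefinite_description _ (hk n)))).
  (* A centre for each [U n] that meets the Cantor set; for the others any sequence will do. *)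
  assert (hc : forall n, exists c, (exists a, (forall i, In (a i) (F i)) /\ U n (val d a)) ->
                (forall i, In (c i) (F i)) /\ U n (val d c)).
  { intros n. destruct (classic (exists a, (forall i, In (a i) (F i)) /\ U n (val d a)))
      as [[a ha]|h].
    - exists a. auto.
    - exists (fun _ => 0%nat). tauto. }
  set (c := fun n => proj1_sig (constructive_indefinite_description _ (hc n))).
  assert (hc' : forall n, (exists a, (forall i, In (a i) (F i)) /\ U n (val d a)) ->
                (forall i, In (c n i) (F i)) /\ U n (val d (c n)))
    by (intros n; apply (proj2_sig (constructive_indefinite_description _ (hc n)))).
  destruct (mass_distribution F c k (/ 2) hnd hne ltac:(lra)) as [a [ha hesc]].
  - intros N.
    apply (Rle_trans _ (sum_f_R0 (fun n => Rpower (D n) s * (C * Rpower (INR d) s)) N)).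
    + apply sum_Rle. intros n _. apply (Rle_trans _ _ _ (hmass (k n))).
      destruct (hk' n) as [hlo _].
      assert (hp : 0 < / INR d ^ k n) by (apply Rinv_0_lt_compat, pow_lt; lra).
      (* The upper bound on the mass is in terms of [d^-k], while [D n] is only bounded below by
         [d^-(k+1)]: this costs the factor [d^s]. *)
      replace (/ INR d ^ k n) with (INR d * / INR d ^ S (k n)).
      * assert (hp' : 0 < / INR d ^ S (k n)) by (apply Rinv_0_lt_compat, pow_lt; lra).
        rewrite <- Rpower_mult_distr by lra.
        assert (Rpower (/ INR d ^ S (k n)) s <= Rpower (D n) s).
        { apply Rle_Rpower_l; [exact hs|split; assumption]. }
        assert (0 < Rpower (/ INR d ^ S (k n)) s) by apply exp_pos.
        rewrite (Rmult_comm (Rpower (D n) s)), Rmult_assoc.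
        apply Rmult_le_compat_l; [lra|]. apply Rmult_le_compat_l; lra.
      * simpl. field. split; [apply pow_nonzero|]; lra.
    + rewrite <- scal_sum.
      assert (hS : sum_f_R0 (fun n => Rpower (D n) s) N <= l).
      { apply (growing_ineq (sum_f_R0 (fun n => Rpower (D n) s))).
        - intros m. simpl. assert (0 < Rpower (D (S m)) s) by apply exp_pos. lra.
        - exact hsum. }
      assert (he : C * Rpower (INR d) s * eps = / 2).
      { unfold eps. field. split; lra. }
      assert (0 < C * Rpower (INR d) s) by nra.
      nra.
  - destruct (hcov _ (hX a ha)) as [n hn].
    destruct (hc' n (ex_intro _ a (conj ha hn))) as [hcF hcU].
    destruct (hesc n) as [i [hi hne']]. apply hne'.
    apply (val_inj_prefix d E (k n) a (c n)); auto.
    + intros i'. apply (hinc i'), ha.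
    + intros i'. apply (hinc i'), hcF.
    + apply (Rle_lt_trans _ (D n)); [apply (hdiam n); assumption|apply hk'].
Qed.

(** * Cantor sets of sequences that differ from [u] at all multiples of [m] *)

Lemma Rpower_inv_pow (x s : R) (k : nat) :
  0 < x -> Rpower (/ x ^ k) s = / Rpower x s ^ k.
Proof.
  intros hx.
  rewrite <- (Rpower_pow k (Rpower x s)) by apply exp_pos.
  rewrite <- (Rpower_pow k x) by exact hx.
  rewrite <- !Rpower_Ropp, !Rpower_mult. f_equal. ring.
Qed.

Lemma two_pow_le_pow (r : R) (m k : nat) :
  (0 < m)%nat -> 1 <= r -> 2 <= r ^ m -> 2 ^ (k / m) <= r ^ k.
Proof.
  intros hm hr h2.
  apply (Rle_trans _ (r ^ (m * (k / m)))).
  - rewrite pow_mult. apply pow_incr. lra.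
  - apply Rle_pow; [exact hr|]. apply Nat.Div0.mul_div_le.
Qed.

Definition avoid_at_multiples (E : list nat) (u : nat -> nat) (m i : nat) : list nat :=
  if (i mod m =? 0)%nat then filter (fun e => negb (e =? u i)%nat) E else E.

Lemma length_filter_neq (E : list nat) (x : nat) :
  NoDup E -> (length E <= S (length (filter (fun e => negb (e =? x)%nat) E)))%nat.
Proof.
  intros h.
  apply (NoDup_incl_length (l' := x :: filter (fun e => negb (e =? x)%nat) E) h).
  intros e he. destruct (Nat.eqb_spec e x) as [->|hne]; [left; reflexivity|right].
  apply filter_In. split; [exact he|]. apply Bool.negb_true_iff, Nat.eqb_neq, hne.
Qed.

Lemma length_avoid_at_multiples (E : list nat) (u : nat -> nat) (m i : nat) :
  NoDup E -> (length E <= S (length (avoid_at_multiples E u m i)))%nat.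
Proof.
  intros h. unfold avoid_at_multiples.
  destruct (i mod m =? 0)%nat; [apply length_filter_neq, h|lia].
Qed.

(** The quotient [(k + m - 1) / m] counts the multiples of [m] below [k]. *)
Lemma div_ceil_S (k m : nat) : (0 < m)%nat ->
  ((S k + m - 1) / m = (k + m - 1) / m + if k mod m =? 0 then 1 else 0)%nat.
Proof.
  intros hm.
  pose proof (Nat.div_mod_eq k m) as hk. pose proof (Nat.mod_upper_bound k m ltac:(lia)) as hr.
  set (q := (k / m)%nat) in *. set (r := (k mod m)%nat) in *.
  destruct (Nat.eqb_spec r 0) as [e|e].
  - rewrite <- (Nat.div_unique (S k + m - 1) m (q + 1) 0) by lia.
    rewrite <- (Nat.div_unique (k + m - 1) m q (m - 1)) by lia. lia.
  - rewrite <- (Nat.div_unique (S k + m - 1) m (q + 1) r) by lia.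
    rewrite <- (Nat.div_unique (k + m - 1) m (q + 1) (r - 1)) by lia. lia.
Qed.

(** Removing one digit out of [n >= 2] multiplies the mass by at most [n / (n - 1) <= 2], once per
    multiple of [m] below [k]. *)
Lemma mass_avoid_at_multiples (E : list nat) (u : nat -> nat) (m k : nat) :
  NoDup E -> (2 <= length E)%nat -> (0 < m)%nat ->
  mass (avoid_at_multiples E u m) 0 k <= 2 ^ ((k + m - 1) / m) / INR (length E) ^ k.
Proof.
  intros hnd hE hm. pose proof (INR_base_ge2 _ hE) as h2.
  induction k as [|k IH].
  - simpl mass. assert (1 <= 2 ^ ((0 + m - 1) / m)) by (apply pow_R1_Rle; lra).
    simpl pow at 2. lra.
  - rewrite mass_S_r, div_ceil_S, pow_add by exact hm. rewrite Nat.add_0_l.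
    set (n := length E) in *.
    replace (2 ^ ((k + m - 1) / m) * 2 ^ (if (k mod m =? 0)%nat then 1 else 0) / INR n ^ S k)
      with (2 ^ ((k + m - 1) / m) / INR n ^ k
            * (2 ^ (if (k mod m =? 0)%nat then 1 else 0) / INR n))
      by (simpl; field; repeat split; try apply pow_nonzero; lra).
    pose proof (length_avoid_at_multiples E u m k hnd) as hlen. fold n in hlen.
    assert (hpos : 0 < INR (length (avoid_at_multiples E u m k))) by (apply lt_0_INR; lia).
    apply Rmult_le_compat; [ | | exact IH | ].
    + left. apply mass_pos. intros i hi.
      pose proof (length_avoid_at_multiples E u m i hnd) as hl. rewrite hi in hl.
      simpl in hl. lia.
    + left; apply Rinv_0_lt_compat, hpos.
    + unfold avoid_at_multiples in *. destruct (k mod m =? 0)%nat.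
      * set (l := length (filter _ E)) in *. fold l.
        apply le_INR in hlen. rewrite S_INR in hlen.
        simpl pow. apply (Rmult_le_reg_r (INR l * INR n)); [nra|].
        field_simplify; lra.
      * simpl pow. fold n. lra.
Qed.

(** The shared lower bound for the dimensions of [J] and of the badly approximable set. If
    [d^s < n], the geometric gain [(n / d^s)^k] absorbs the loss [2^(k/m)] once [m] is large. *)
Lemma null_exponent_ge (d : nat) (E : list nat) (u : nat -> nat) (X : R -> Prop) (s : R) :
  (2 <= d)%nat -> (forall e, In e E -> (e < d)%nat) ->
  (forall x y, In x E -> In y E -> x <> S y) ->
  NoDup E -> (2 <= length E)%nat ->
  (forall m b, (0 < m)%nat -> digits E b ->
     (forall i, (i mod m = 0)%nat -> b i <> u i) -> X (val d b)) ->
  0 <= s -> Hausdorff_null s X -> INR (length E) <= Rpower (INR d) s.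
Proof.
  intros hd hE hgap hnd hlen hX hs hnull.
  destruct (Rle_lt_dec (INR (length E)) (Rpower (INR d) s)) as [h|h]; [exact h|exfalso].
  pose proof (INR_base_ge2 d hd) as h2.
  set (Q := Rpower (INR d) s) in *. assert (hQ : 0 < Q) by apply exp_pos.
  set (n := INR (length E)) in *.
  assert (hr : 1 < n / Q).
  { apply (Rmult_lt_reg_r Q); [exact hQ|]. field_simplify; lra. }
  destruct (Pow_x_infinity (n / Q) ltac:(rewrite Rabs_pos_eq; lra) 2) as [m0 hm0].
  set (m := S m0). assert (hm : (0 < m)%nat) by lia.
  specialize (hm0 m ltac:(lia)).
  rewrite Rabs_pos_eq in hm0 by (apply pow_le; lra).
  apply Rge_le in hm0.
  revert hnull.
  (* The constant 2 pays for rounding [k / m] up instead of down. *)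
  apply (cantor_not_null d E (avoid_at_multiples E u m) X s 2); auto; try lra.
  - intros i. unfold avoid_at_multiples. destruct (i mod m =? 0)%nat; [apply NoDup_filter|]; exact hnd.
  - intros i hi. pose proof (length_avoid_at_multiples E u m i hnd) as hl. rewrite hi in hl.
    simpl in hl. lia.
  - intros i e. unfold avoid_at_multiples. destruct (i mod m =? 0)%nat; [|auto].
    intros he; apply filter_In in he; apply he.
  - intros b hb. apply (hX m b hm).
    + intros i. specialize (hb i). unfold avoid_at_multiples in hb.
      destruct (i mod m =? 0)%nat; [apply filter_In in hb|]; apply hb.
    + intros i hi. specialize (hb i). unfold avoid_at_multiples in hb.
      rewrite hi in hb. simpl in hb. apply filter_In in hb. destruct hb as [_ hb].
      apply Bool.negb_true_iff, Nat.eqb_neq in hb. exact hb.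
  - intros k. apply (Rle_trans _ _ _ (mass_avoid_at_multiples E u m k hnd hlen hm)).
    rewrite Rpower_inv_pow by lra. fold Q n.
    assert (hc : 2 ^ ((k + m - 1) / m) <= 2 * (n / Q) ^ k).
    { apply (Rle_trans _ (2 * 2 ^ (k / m))).
      - change (2 * 2 ^ (k / m)) with (2 ^ S (k / m)). apply Rle_pow; [lra|].
        replace (S (k / m)) with ((k + 1 * m) / m)%nat by (rewrite Nat.div_add; lia).
        apply Nat.Div0.div_le_mono. lia.
      - apply Rmult_le_compat_l; [lra|]. apply two_pow_le_pow; auto; lra. }
    assert (hnk : 0 < n ^ k) by (apply pow_lt; nra).
    apply (Rmult_le_reg_r (n ^ k)); [exact hnk|].
    replace (2 ^ ((k + m - 1) / m) / n ^ k * n ^ k) with (2 ^ ((k + m - 1) / m))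
      by (field; lra).
    apply (Rle_trans _ _ _ hc). right. unfold Rdiv. rewrite Rpow_mult_distr, pow_inv. ring.
Qed.

(** * Null sets *)

Lemma Hausdorff_null_subset (s : R) (A B : R -> Prop) :
  (forall x, A x -> B x) -> Hausdorff_null s B -> Hausdorff_null s A.
Proof.
  intros h hB delta eps hdelta heps.
  destruct (hB delta eps hdelta heps) as [U [D [l [hc hr]]]].
  exists U, D, l. split; auto.
Qed.

Lemma Hausdorff_null_translate (s x : R) (A : R -> Prop) :
  Hausdorff_null s A -> Hausdorff_null s (fun y => A (y + x)).
Proof.
  intros hA delta eps hdelta heps.
  destruct (hA delta eps hdelta heps) as [U [D [l [hc [hD [hd hr]]]]]].
  exists (fun n y => U n (y + x)), D, l. repeat split; try apply hD; try apply hr.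
  - intros y hy. apply hc, hy.
  - intros n a b ha hb. specialize (hd n _ _ ha hb).
    now replace (a - b) with (a + x - (b + x)) by ring.
Qed.

(** A single diameter bound is enough because the covers below consist of cylinders of one rank. *)
Definition finite_cover (s : R) (A : R -> Prop) (delta eps : R) : Prop :=
  exists (N : nat) (U : nat -> R -> Prop) (D : R),
    0 < D < delta /\ INR N * Rpower D s < eps /\
    (forall x, A x -> exists i, (i < N)%nat /\ U i x) /\
    (forall i a b, U i a -> U i b -> Rabs (a - b) <= D).

Lemma lsum_le {A : Type} (f g : A -> R) (l : list A) :
  (forall x, f x <= g x) -> lsum f l <= lsum g l.
Proof.
  intros h. induction l as [|x l IH]; [simpl; lra|]. rewrite !lsum_cons.
  specialize (h x). lra.
Qed.

Lemma lsum_app {A : Type} (f : A -> R) (l l' : list A) :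
  lsum f (l ++ l') = lsum f l + lsum f l'.
Proof.
  induction l as [|x l IH]; [simpl; ring|].
  rewrite <- app_comm_cons, !lsum_cons, IH. ring.
Qed.

Lemma lsum_map {A B : Type} (f : B -> R) (h : A -> B) (l : list A) :
  lsum f (map h l) = lsum (fun x => f (h x)) l.
Proof.
  induction l as [|x l IH]; [reflexivity|]. simpl map. rewrite !lsum_cons, IH. reflexivity.
Qed.

Lemma lsum_list_prod {A B : Type} (f : A * B -> R) (l : list A) (l' : list B) :
  lsum f (list_prod l l') = lsum (fun x => lsum (fun y => f (x, y)) l') l.
Proof.
  induction l as [|x l IH]; [reflexivity|].
  simpl list_prod. rewrite lsum_app, lsum_cons, lsum_map, IH. reflexivity.
Qed.

Lemma lsum_incl_le {A : Type} (f : A -> R) (l : list A) : forall l',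
  (forall x, 0 <= f x) -> NoDup l -> incl l l' -> lsum f l <= lsum f l'.
Proof.
  induction l as [|x l IH]; intros l' hf hnd hinc.
  - clear hinc. induction l' as [|y l' IH']; [simpl; lra|].
    rewrite lsum_cons. specialize (hf y). lra.
  - destruct (in_split x l' (hinc x (or_introl eq_refl))) as [l1 [l2 ->]].
    inversion_clear hnd as [|? ? hx hl].
    rewrite lsum_app, !lsum_cons.
    assert (h : lsum f l <= lsum f (l1 ++ l2)).
    { apply IH; auto. intros y hy.
      specialize (hinc y (or_intror hy)). apply in_app_or in hinc. apply in_or_app.
      destruct hinc as [h|[h|h]]; [left; exact h| |right; exact h].
      subst y. contradiction. }
    rewrite lsum_app in h. lra.
Qed.

Lemma sum_f_R0_lsum (f : nat -> R) (N : nat) : sum_f_R0 f N = lsum f (seq 0 (S N)).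
Proof.
  induction N as [|N IH]; [simpl; ring|].
  rewrite seq_S, lsum_app, <- IH, lsum_cons. simpl. ring.
Qed.

Lemma lsum_indicator_le (N n : nat) (w : R) : 0 <= w ->
  lsum (fun i => if (i <? N)%nat then w else 0) (seq 0 n) <= INR N * w.
Proof.
  intros hw.
  assert (h : lsum (fun i => if (i <? N)%nat then w else 0) (seq 0 n) = INR (min n N) * w).
  { induction n as [|n IH]; [simpl; ring|].
    rewrite seq_S, lsum_app, IH, lsum_cons, Nat.add_0_l.
    destruct (Nat.ltb_spec n N).
    - rewrite !Nat.min_l by lia. rewrite S_INR. simpl lsum. ring.
    - rewrite !Nat.min_r by lia. simpl lsum. ring. }
  rewrite h. apply Rmult_le_compat_r; [exact hw|]. apply le_INR. lia.
Qed.

Lemma sum_half_pow_le (e : R) (N : nat) :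
  0 <= e -> sum_f_R0 (fun p => e * (/ 2) ^ p) N <= 2 * e.
Proof.
  intros he.
  assert (h : sum_f_R0 (fun p => e * (/ 2) ^ p) N = 2 * e - e * (/ 2) ^ N).
  { induction N as [|N IH]; [simpl; ring|]. simpl sum_f_R0. rewrite IH. simpl. field. }
  rewrite h. assert (0 <= (/ 2) ^ N) by (apply pow_le; lra). nra.
Qed.

Lemma infinite_sum_of_bounded (f : nat -> R) (B : R) :
  (forall n, 0 <= f n) -> (forall N, sum_f_R0 f N <= B) ->
  exists l, infinite_sum f l /\ l <= B.
Proof.
  intros hf hB.
  destruct (growing_cv (sum_f_R0 f)) as [l hl].
  - intros n. simpl. specialize (hf (S n)). lra.
  - exists B. intros x [n ->]. apply hB.
  - exists l. split; [exact hl|].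
    apply (is_lim_seq_le (sum_f_R0 f) (fun _ => B) l B hB); [|apply is_lim_seq_const].
    apply is_lim_seq_Reals, hl.
Qed.

(* The indices [p] that do not code a piece of one of the finite covers get an empty set with a
   tiny positive diameter bound, since [Hausdorff_null] demands [D p > 0]. *)
Lemma Hausdorff_null_countable (s : R) (A : nat -> R -> Prop) :
  0 < s ->
  (forall M delta eps, 0 < delta -> 0 < eps -> finite_cover s (A M) delta eps) ->
  Hausdorff_null s (fun x => exists M, A M x).
Proof.
  intros hs hA delta eps hdelta heps.
  (* The sum of [h] is at most [eps / 4]; it is spent twice, on the finite covers and on the filler
     sets. *)
  set (h := fun p : nat => eps / 8 * (/ 2) ^ p).
  assert (hh : forall p, 0 < h p).
  { intros p. unfold h. apply Rmult_lt_0_compat; [lra|]. apply pow_lt; lra. }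
  assert (hcov : forall M, exists c : nat * (nat -> R -> Prop) * R,
    0 < snd c < delta /\ INR (fst (fst c)) * Rpower (snd c) s < h M /\
    (forall x, A M x -> exists i, (i < fst (fst c))%nat /\ snd (fst c) i x) /\
    (forall i a b, snd (fst c) i a -> snd (fst c) i b -> Rabs (a - b) <= snd c)).
  { intros M. destruct (hA M delta (h M) hdelta (hh M)) as [N [U [D hc]]].
    exists (N, U, D). exact hc. }
  set (c := fun M => proj1_sig (constructive_indefinite_description _ (hcov M))).
  assert (hc : forall M, 0 < snd (c M) < delta /\
    INR (fst (fst (c M))) * Rpower (snd (c M)) s < h M /\
    (forall x, A M x -> exists i, (i < fst (fst (c M)))%nat /\ snd (fst (c M)) i x) /\
    (forall i a b, snd (fst (c M)) i a -> snd (fst (c M)) i b -> Rabs (a - b) <= snd (c M)))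
    by (intros M; apply (proj2_sig (constructive_indefinite_description _ (hcov M)))).
  set (cnt := fun M => fst (fst (c M))) in *.
  set (U := fun M => snd (fst (c M))) in *.
  set (D := fun M => snd (c M)) in *.
  set (r := fun p => Rmin (delta / 2) (Rpower (h p) (/ s))).
  assert (hr : forall p, 0 < r p < delta /\ Rpower (r p) s <= h p).
  { intros p. unfold r.
    assert (0 < Rpower (h p) (/ s)) by apply exp_pos.
    assert (0 < Rmin (delta / 2) (Rpower (h p) (/ s))) by (apply Rmin_pos; lra).
    pose proof (Rmin_l (delta / 2) (Rpower (h p) (/ s))).
    pose proof (Rmin_r (delta / 2) (Rpower (h p) (/ s))).
    split; [lra|].
    apply (Rle_trans _ (Rpower (Rpower (h p) (/ s)) s)).
    - apply Rle_Rpower_l; lra.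
    - rewrite Rpower_mult, Rinv_l, Rpower_1 by (try apply hh; lra). lra. }
  set (g := fun x : nat * nat =>
    if (snd x <? cnt (fst x))%nat then Rpower (D (fst x)) s else 0).
  assert (hg : forall x, 0 <= g x).
  { intros x. unfold g. destruct (_ <? _)%nat; [left; apply exp_pos|lra]. }
  set (V := fun p x => let (M, i) := Cantor.of_nat p in (i < cnt M)%nat /\ U M i x).
  set (W := fun p => let (M, i) := Cantor.of_nat p in
                     if (i <? cnt M)%nat then D M else r p).
  assert (hW : forall p, Rpower (W p) s <= g (Cantor.of_nat p) + h p).
  { intros p. unfold W, g. destruct (Cantor.of_nat p) as [M i]. simpl.
    specialize (hh p). destruct (i <? cnt M)%nat; [lra|]. destruct (hr p). lra. }
  destruct (infinite_sum_of_bounded (fun p => Rpower (W p) s) (eps / 2)) as [l [hl hle]].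
  - intros p. left; apply exp_pos.
  - intros N.
    apply (Rle_trans _ (sum_f_R0 (fun p => g (Cantor.of_nat p) + h p) N));
      [apply sum_Rle; intros; apply hW|].
    rewrite plus_sum.
    assert (h1 : sum_f_R0 h N <= 2 * (eps / 8)) by (apply sum_half_pow_le; lra).
    assert (h2 : sum_f_R0 (fun p => g (Cantor.of_nat p)) N <= 2 * (eps / 8)).
    (* The codes up to [N] decode to pairs with both entries at most [N], so the partial sum is
       dominated by a double sum over a square. *)
    { rewrite sum_f_R0_lsum, <- (lsum_map g Cantor.of_nat).
      apply (Rle_trans _ (lsum g (list_prod (seq 0 (S N)) (seq 0 (S N))))).
      - apply lsum_incl_le; auto.
        + apply NoDup_map_NoDup_ForallPairs; [|apply seq_NoDup].
          intros p p' _ _ e. rewrite <- (Cantor.cancel_to_of p), e. apply Cantor.cancel_to_of.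
        + intros [M i] hx. apply in_map_iff in hx. destruct hx as [p [e hp]].
          apply in_seq in hp.
          pose proof (Cantor.to_nat_non_decreasing M i) as hle.
          rewrite <- e, Cantor.cancel_to_of in hle.
          apply in_prod; apply in_seq; lia.
      - rewrite lsum_list_prod.
        apply (Rle_trans _ (lsum h (seq 0 (S N)))).
        + apply lsum_le. intros M.
          apply (Rle_trans _ (INR (cnt M) * Rpower (D M) s)).
          * apply (lsum_indicator_le (cnt M) (S N) (Rpower (D M) s)). left; apply exp_pos.
          * left; apply hc.
        + rewrite <- sum_f_R0_lsum. exact h1. }
    lra.
  - exists V, W, l. repeat split.
    + intros x [M hx]. destruct (hc M) as [_ [_ [hcM _]]].
      destruct (hcM x hx) as [i [hi hU]]. exists (Cantor.to_nat (M, i)).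
      unfold V. rewrite Cantor.cancel_of_to. split; assumption.
    + unfold W. destruct (Cantor.of_nat n) as [M i].
      destruct (i <? cnt M)%nat; [apply hc|apply hr].
    + unfold W. destruct (Cantor.of_nat n) as [M i].
      destruct (i <? cnt M)%nat; [apply hc|apply hr].
    + intros p a b. unfold V, W. destruct (Cantor.of_nat p) as [M i].
      intros [hi ha] [_ hb]. apply Nat.ltb_lt in hi. rewrite hi.
      destruct (hc M) as [_ [_ [_ hd]]]. apply (hd i); assumption.
    + exact hl.
    + lra.
Qed.

(** * Covers by cylinders and word counting *)

Lemma finite_cover_words (d : nat) (E : list nat) (A : R -> Prop) (L : list (list nat))
  (k : nat) (s delta eps : R) :
  (2 <= d)%nat -> (forall e, In e E -> (e < d)%nat) ->
  (forall x, A x -> exists a, digits E a /\ x = val d a /\ In (map a (seq 0 k)) L) ->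
  / INR d ^ k < delta -> INR (length L) * / Rpower (INR d) s ^ k < eps ->
  finite_cover s A delta eps.
Proof.
  intros hd hE hA hdelta heps. pose proof (INR_base_ge2 d hd) as h2.
  exists (length L), (fun i x => exists a, digits E a /\ x = val d a /\
                        map a (seq 0 k) = nth i L nil), (/ INR d ^ k).
  repeat split.
  - apply Rinv_0_lt_compat, pow_lt; lra.
  - exact hdelta.
  - rewrite Rpower_inv_pow by lra. exact heps.
  - intros x hx. destruct (hA x hx) as [a [ha [e hin]]].
    destruct (In_nth _ _ nil hin) as [i [hi hn]].
    exists i. split; [exact hi|]. exists a. auto.
  - intros i x y [a [ha [-> ea]]] [b [hb [-> eb]]].
    apply val_agree; auto.
    intros j hj. rewrite <- eb in ea.
    pose proof (ext_in_map ea j) as h. apply h. apply in_seq. lia.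
Qed.

Fixpoint words (E : list nat) (k : nat) : list (list nat) :=
  match k with
  | O => nil :: nil
  | S k => map (fun p => fst p ++ snd p :: nil) (list_prod (words E k) E)
  end.

Lemma length_words (E : list nat) (k : nat) : length (words E k) = (length E ^ k)%nat.
Proof.
  induction k as [|k IH]; [reflexivity|]. simpl. rewrite length_map, length_prod, IH. lia.
Qed.

Lemma In_words_prefix (E : list nat) (a : nat -> nat) (j k : nat) :
  digits E a -> In (map a (seq j k)) (words E k).
Proof.
  intros ha. induction k as [|k IH]; [left; reflexivity|].
  rewrite seq_S, map_app. simpl words. apply in_map_iff.
  exists (map a (seq j k), a (j + k)%nat). split; [reflexivity|].
  apply in_prod; [exact IH|apply ha].
Qed.

Lemma In_words (E : list nat) (w : list nat) : incl w E -> In w (words E (length w)).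
Proof.
  induction w as [|x w IH] using rev_ind; intros h; [left; reflexivity|].
  rewrite length_app, Nat.add_1_r. simpl words. apply in_map_iff.
  exists (w, x). split; [reflexivity|]. apply in_prod.
  - apply IH. intros y hy. apply h, in_or_app. left; exact hy.
  - apply h, in_or_app. right; left; reflexivity.
Qed.

(** After [k] free digits come [j] blocks different from [w]. Only occurrences aligned with the
    blocks are excluded, which suffices for an upper bound on the count. *)
Fixpoint avoiding_words (E w : list nat) (k j : nat) : list (list nat) :=
  match j with
  | O => words E k
  | S j => map (fun p => fst p ++ snd p)
             (list_prod (avoiding_words E w k j)
                (remove (list_eq_dec Nat.eq_dec) w (words E (length w))))
  end.

Lemma length_avoiding_words (E w : list nat) (k j : nat) : incl w E ->
  (length (avoiding_words E w k j) <= length E ^ k * (length E ^ length w - 1) ^ j)%nat.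
Proof.
  intros hw. induction j as [|j IH].
  - simpl. rewrite length_words. lia.
  - simpl avoiding_words. rewrite length_map, length_prod, Nat.pow_succ_r'.
    pose proof (remove_length_lt (list_eq_dec Nat.eq_dec) _ _ (In_words E w hw)) as h.
    rewrite length_words in h.
    rewrite (Nat.mul_comm (length E ^ length w - 1)), Nat.mul_assoc.
    apply Nat.mul_le_mono; [exact IH|lia].
Qed.

Lemma In_avoiding_words (E w : list nat) (a : nat -> nat) (k j : nat) :
  digits E a -> (forall i, (k <= i)%nat -> ~ occurs w a i) ->
  In (map a (seq 0 (k + j * length w))) (avoiding_words E w k j).
Proof.
  intros ha hav. induction j as [|j IH].
  - simpl. rewrite Nat.add_0_r. apply In_words_prefix; exact ha.
  - replace (k + S j * length w)%nat with (k + j * length w + length w)%nat by lia.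
    rewrite seq_app, map_app. simpl avoiding_words. apply in_map_iff.
    exists (map a (seq 0 (k + j * length w)), map a (seq (0 + (k + j * length w)) (length w))).
    split; [reflexivity|]. apply in_prod; [exact IH|].
    apply in_in_remove; [|apply In_words_prefix; exact ha].
    apply (hav (0 + (k + j * length w))%nat). lia.
Qed.

Lemma inv_pow_small (x delta : R) : 1 < x -> 0 < delta ->
  exists N, forall n, (N <= n)%nat -> / x ^ n < delta.
Proof.
  intros hx hdelta.
  assert (h : Rabs (/ x) < 1).
  { rewrite Rabs_pos_eq by (left; apply Rinv_0_lt_compat; lra).
    rewrite <- Rinv_1. apply Rinv_lt_contravar; lra. }
  destruct (pow_lt_1_zero _ h delta hdelta) as [N hN].
  exists N. intros n hn. specialize (hN n hn). rewrite pow_inv in hN.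
  now apply Rabs_def2 in hN.
Qed.

Lemma Jset_null (d : nat) (E : list nat) (s : R) :
  (2 <= d)%nat -> (forall e, In e E -> (e < d)%nat) -> E <> nil ->
  0 < s -> INR (length E) < Rpower (INR d) s -> Hausdorff_null s (Jset d E).
Proof.
  intros hd hE hne hs hQ. pose proof (INR_base_ge2 d hd) as h2.
  (* A constant union gives access to the passage from finite covers to null sets. *)
  apply (Hausdorff_null_subset _ _ (fun x => exists _ : nat, Jset d E x));
    [intros x hx; exists 0%nat; exact hx|].
  apply (Hausdorff_null_countable s (fun _ => Jset d E) hs).
  intros _ delta eps hdelta heps.
  set (Q := Rpower (INR d) s) in *.
  assert (hn : 0 < INR (length E)).
  { apply lt_0_INR. destruct E; [congruence|simpl; lia]. }
  destruct (inv_pow_small (INR d) delta ltac:(lra) hdelta) as [N1 hN1].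
  destruct (inv_pow_small (Q / INR (length E)) eps) as [N2 hN2]; [|exact heps|].
  { apply (Rmult_lt_reg_r (INR (length E))); [exact hn|]. field_simplify; lra. }
  set (k := max N1 N2).
  apply (finite_cover_words d E _ (words E k) k); auto.
  - intros x [a [ha hx]]. exists a. split; [exact ha|].
    split; [apply val_infinite_sum, hx|apply In_words_prefix; exact ha].
  - apply hN1. lia.
  - specialize (hN2 k ltac:(lia)). fold Q.
    rewrite length_words, pow_INR.
    replace (INR (length E) ^ k * / Q ^ k) with (/ (Q / INR (length E)) ^ k); [exact hN2|].
    unfold Rdiv. rewrite Rpow_mult_distr, pow_inv, Rinv_mult, Rinv_inv. ring.
Qed.

(** The critical exponent [d^s = n] is allowed: each block of length [L] contributes a factor
    [(n^L - 1) / n^L < 1]. *)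
Lemma avoiding_finite_cover (d : nat) (E w : list nat) (M : nat) (s delta eps : R) :
  (2 <= d)%nat -> (forall e, In e E -> (e < d)%nat) -> E <> nil ->
  incl w E -> w <> nil -> INR (length E) <= Rpower (INR d) s ->
  0 < delta -> 0 < eps ->
  finite_cover s
    (fun x => exists a, digits E a /\ x = val d a /\
                forall k, (M <= k)%nat -> ~ occurs w a k) delta eps.
Proof.
  intros hd hE hne hw hwne hQ hdelta heps. pose proof (INR_base_ge2 d hd) as h2.
  set (Q := Rpower (INR d) s) in *. set (L := length w).
  assert (hL : (0 < L)%nat) by (unfold L; destruct w; [congruence|simpl; lia]).
  set (n := INR (length E)) in *.
  assert (hn : 0 < n).
  { apply lt_0_INR. destruct E; [congruence|simpl; lia]. }
  assert (hnL : 0 < n ^ L) by (apply pow_lt, hn).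
  assert (hnL1 : (1 <= length E ^ L)%nat).
  { destruct E; [congruence|]. apply Nat.neq_0_lt_0, Nat.pow_nonzero. simpl; lia. }
  destruct (inv_pow_small (INR d) delta ltac:(lra) hdelta) as [N1 hN1].
  set (y := (n ^ L - 1) / n ^ L).
  assert (hy0 : 0 <= n ^ L - 1).
  { apply le_INR in hnL1. rewrite pow_INR in hnL1. simpl INR in hnL1. fold n in hnL1. lra. }
  assert (hy : 0 <= y < 1).
  { unfold y. split; [apply Rle_mult_inv_pos; lra|].
    apply (Rmult_lt_reg_r (n ^ L)); [exact hnL|]. field_simplify; lra. }
  destruct (pow_lt_1_zero y ltac:(rewrite Rabs_pos_eq; lra) eps heps) as [N2 hN2].
  set (j := max N1 N2).
  apply (finite_cover_words d E _ (avoiding_words E w M j) (M + j * L)); auto.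
  - intros x [a [ha [e hav]]]. exists a. repeat split; auto.
    apply In_avoiding_words; assumption.
  - apply hN1. nia.
  - fold Q. specialize (hN2 j ltac:(lia)).
    rewrite Rabs_pos_eq in hN2 by (apply pow_le; lra).
    apply (Rle_lt_trans _ (y ^ j)); [|exact hN2].
    apply (Rle_trans _ (n ^ M * (n ^ L - 1) ^ j * / n ^ (M + j * L))).
    + apply Rmult_le_compat.
      * apply pos_INR.
      * left; apply Rinv_0_lt_compat, pow_lt; lra.
      * pose proof (length_avoiding_words E w M j hw) as hlen.
        apply le_INR in hlen. rewrite mult_INR, !pow_INR, minus_INR, pow_INR in hlen by exact hnL1.
        exact hlen.
      * apply Rinv_le_contravar; [apply pow_lt, hn|]. apply pow_incr. lra.
    + right. unfold y, Rdiv.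
      rewrite pow_add, (Nat.mul_comm j), pow_mult, Rpow_mult_distr, pow_inv.
      field. split; apply pow_nonzero; lra.
Qed.

(** * The dimension of [J] and the conclusion *)

Lemma Jset_val (d : nat) (E : list nat) (x : R) :
  (2 <= d)%nat -> (forall e, In e E -> (e < d)%nat) ->
  Jset d E x <-> exists a, digits E a /\ x = val d a.
Proof.
  intros hd hE. split.
  - intros [a [ha hx]]. exists a. split; [exact ha|apply val_infinite_sum, hx].
  - intros [a [ha ->]]. exists a. split; [exact ha|].
    apply infinite_sum_val; [exact hd|intros i; apply hE, ha].
Qed.

Lemma Hausdorff_dim_Jset (d : nat) (E : list nat) (delta : R) :
  (2 <= d)%nat -> (forall e, In e E -> (e < d)%nat) ->
  (forall x y, In x E -> In y E -> x <> S y) ->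
  NoDup E -> (2 <= length E)%nat -> Hausdorff_dim (Jset d E) delta ->
  0 < delta /\ Rpower (INR d) delta = INR (length E).
Proof.
  intros hd hE hgap hnd hlen [hlb hglb].
  pose proof (INR_base_ge2 d hd) as h2. pose proof (INR_base_ge2 _ hlen) as hn2.
  set (n := INR (length E)) in *.
  set (s0 := ln n / ln (INR d)).
  assert (hlnd : 0 < ln (INR d)) by (rewrite <- ln_1; apply ln_increasing; lra).
  assert (hlnn : 0 < ln n) by (rewrite <- ln_1; apply ln_increasing; lra).
  assert (hs0 : 0 < s0) by (apply Rdiv_lt_0_compat; assumption).
  assert (hQ0 : Rpower (INR d) s0 = n).
  { unfold Rpower, s0. replace (ln n / ln (INR d) * ln (INR d)) with (ln n) by (field; lra).
    apply exp_ln. lra. }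
  assert (e : delta = s0).
  { apply Rle_antisym.
    - apply Rnot_lt_le. intros h.
      (* [J] is null at every exponent above [s0], in particular at this midpoint, which would lie
         below the infimum. *)
      assert (hmid : delta <= (s0 + delta) / 2).
      { apply hlb. split; [lra|]. apply Jset_null; auto; [|lra|].
        - intros ->; simpl in hlen; lia.
        - fold n. rewrite <- hQ0. apply Rpower_lt; lra. }
      lra.
    - apply hglb. intros s [hs hnull]. apply Rnot_lt_le. intros h.
      assert (hq : n <= Rpower (INR d) s).
      { apply (null_exponent_ge d E (fun _ => 0%nat) (Jset d E)); auto; [|lra].
        intros m b _ hb _. apply Jset_val; eauto. }
      rewrite <- hQ0 in hq. apply (Rpower_lt (INR d)) in h; lra. }
  subst delta. auto.
Qed.

Theorem theorem3p7 (d : nat) (E : list nat)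
  (hd : (2 <= d)%nat)
  (hEnd : NoDup E) (hEd : forall e, In e E -> (e < d)%nat)
  (hcard : (1 < length E < d)%nat)
  (hprime : prime (Z.of_nat d))
  (h0 : In 0%nat E) (hlast : In (d - 1)%nat E)
  (hgap : forall a b, In a E -> In b E -> a <> S b)
  (delta : R) (hdim : Hausdorff_dim (Jset d E) delta) :
  exists N : R -> Prop,
    Hausdorff_null delta (fun x => Jset d E x /\ N x) /\
    forall x, Jset d E x -> ~ N x ->
      forall K, 0 < K ->
        Hausdorff_dim
          (fun y => badly_intrinsically_approximable
                      (translate (Jset d E) x) (fun _ => K) y)
          delta.
Proof.
  pose proof (INR_base_ge2 d hd) as h2.
  destruct (Hausdorff_dim_Jset d E delta) as [hpos hQ]; auto; try lia.
  (* The exceptional points are those with a non-generic expansion. *)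
  exists (fun x => exists M a, digits E a /\ x = val d a /\
            forall k, (M <= k)%nat -> ~ occurs (pattern d M) a k).
  split.
  - apply (Hausdorff_null_subset _ _ (fun x => exists M, exists a, digits E a /\ x = val d a /\
            forall k, (M <= k)%nat -> ~ occurs (pattern d M) a k)); [intros x [_ h]; exact h|].
    apply Hausdorff_null_countable; [exact hpos|].
    intros M r eps hr heps. apply avoiding_finite_cover; auto.
    + intros ->. destruct h0.
    + intros e he. unfold pattern in he.
      apply in_app_or in he. destruct he as [he|he].
      * apply repeat_spec in he. now subst e.
      * apply in_app_or in he. destruct he as [he|he]; apply repeat_spec in he; now subst e.
    + discriminate.
    + lra.
  - intros x hx hN K hK.
    apply Jset_val in hx; auto. destruct hx as [u [hu ->]].
    assert (hgen : generic d u).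
    { intros M. apply NNPP. intros hno. apply hN. exists M, u. repeat split; auto.
      intros k hk ho. apply hno. exists k. auto. }
    destruct hdim as [hlb hglb]. split.
    (* Translating back by [val d u] lets the Cantor sets be compared inside [J]. *)
    + intros s [hs hnull]. apply (Hausdorff_null_translate _ (- val d u)) in hnull.
      apply Rnot_lt_le. intros hlt.
      assert (hq : INR (length E) <= Rpower (INR d) s).
      { refine (null_exponent_ge d E u _ s hd hEd hgap hEnd (proj1 hcard) _ (Rlt_le _ _ hs) hnull).
        intros m b hm hb hbu. apply (badly_approximable_criterion d E u b m); auto. }
      apply (Rpower_lt (INR d)) in hlt; lra.
    (* The badly approximable set lies in a translate of [J], so exponents null for [J] are null for
       it. *)
    + intros m' hm'. apply hglb. intros s [hs hnull]. apply hm'. split; [exact hs|].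
      apply (Hausdorff_null_subset _ _ (fun y => Jset d E (y + val d u))).
      * intros y [[t [ht ->]] _]. now replace (t - val d u + val d u) with t by ring.
      * apply Hausdorff_null_translate, hnull.
Qed.
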